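(* Let $X_f$ be a random vector in $\mathbb{R}^n$ and $h:\mathbb{R}^n\to\mathbb{R}^d$ an observation operator such that $X_f$ and $h(X_f)$ have finite second moments, and let $R\in\mathbb{R}^{d\times d}$ be a nonsingular covariance matrix (i.e. symmetric positive definite). Let $\Sigma_{xx}=\operatorname{Cov}[X_f]$, $\Sigma_{xh}=\operatorname{Cov}[X_f,h(X_f)]$, $\Sigma_{hh}=\operatorname{Cov}[h(X_f)]$, let $Z_f=X_f-\mathbb{E}[X_f]$, $W_f=h(X_f)-\mathbb{E}[h(X_f)]$, and let $$\Sigma_a=\Sigma_{xx}-\Sigma_{xh}(R+\Sigma_{hh})^{-1}\Sigma_{xh}^{T},\qquad K(s)=\Sigma_{xh}\big((s+1)R+\Sigma_{hh}\big)^{-1}\quad (s\ge 0),\qquad C=R^{-1/2}\Sigma_{hh}R^{-1/2}.$$ Let $\mathcal{I}\subseteq\mathbb{R}$ be an interval, and let $r_t,s_t\ge 0$ be continuous functions of $t\in\mathcal{I}$ such that $$\int_{t\in\mathcal{I}}\frac{r_t}{s_t+c+1}\,dt=\frac{1}{\sqrt{c+1}}$$ for all $c$ in some open set containing $\lambda(C)\cup\{0\}$, where $\lambda(C)$ is the set of eigenvalues of $C$. Define $p_t=r_t(s_t+1)^{-1}$. Then $\int_{t\in\mathcal{I}}p_t\,dt=1$, and if $$Z_a=Z_f-\int_{t\in\mathcal{I}}p_t\,K(s_t)\,W_f\,dt,$$ then $\mathbb{E}[Z_a]=0$ and $\operatorname{Cov}[Z_a]=\Sigma_a$.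
   Context: For random vectors $U,V$, $\operatorname{Cov}[U,V]=\mathbb{E}[(U-\mathbb{E}U)(V-\mathbb{E}V)^T]$ and $\operatorname{Cov}[U]=\operatorname{Cov}[U,U]$. The matrix $\Sigma_a$ is called the Kalman filter analysis covariance, for the observation model $Y=h(X_f)+E_0$ with $E_0\sim\mathcal{N}(0,R)$ independent of $X_f$. The matrix $K(s)$ is the Kalman gain with observation errors inflated by $s$. $R^{-1/2}$ is the inverse of the symmetric positive definite square root of $R$. Integrals of matrix-valued functions are taken entrywise. *)

(* Defs.v *)
From HB Require Import structures.
From mathcomp Require Import all_boot all_order all_algebra.
From mathcomp Require Import all_classical all_reals all_analysis.

Set Implicit Arguments.
Unset Strict Implicit.
Unset Printing Implicit Defensive.

Import Order.TTheory GRing.Theory Num.Theory.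
Import numFieldNormedType.Exports.

Local Open Scope classical_set_scope.
Local Open Scope ring_scope.

(* Vectors are column matrices. As 'cV[R]_n carries no sigma-algebra in the
   library, a random vector is a map T -> 'cV[R]_n with measurable components;
   membership in Lfun P 2 comprises both the measurability of a component and
   the finiteness of its second moment. *)
Definition finite_second_moments d (T : measurableType d) (R : realType)
    (P : probability T R) n (X : T -> 'cV[R]_n) : Prop :=
  forall i, (fun w => X w i 0) \in Lfun P 2%:E.

Definition mxexpectation d (T : measurableType d) (R : realType)
    (P : probability T R) m n (M : T -> 'M[R]_(m, n)) : 'M[R]_(m, n) :=
  \matrix_(i, j) fine ('E_P[fun w => M w i j])%E.

Definition Cov d (T : measurableType d) (R : realType) (P : probability T R)
    m n (U : T -> 'cV[R]_m) (V : T -> 'cV[R]_n) : 'M[R]_(m, n) :=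
  mxexpectation P (fun w =>
    (U w - mxexpectation P U) *m (V w - mxexpectation P V)^T).

Definition mxintegrable (R : realType) (I : set R) m n
    (F : R -> 'M[R]_(m, n)) : Prop :=
  forall i j, lebesgue_measure.-integrable I (fun t => (F t i j)%:E).

Definition mxintegral (R : realType) (I : set R) m n
    (F : R -> 'M[R]_(m, n)) : 'M[R]_(m, n) :=
  \matrix_(i, j) \int[lebesgue_measure]_(t in I) F t i j.

Definition sym_posdef (R : realType) n (A : 'M[R]_n) : Prop :=
  A^T = A /\ forall v : 'cV[R]_n, v != 0 -> 0 < (v^T *m A *m v) 0 0.

(* A symmetric positive definite A has exactly one symmetric positive definite
   square root, so the default value 0 is irrelevant for such A. *)
Definition mxsqrt (R : realType) n (A : 'M[R]_n) : 'M[R]_n :=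
  xget 0 [set S | sym_posdef S /\ S *m S = A].

Definition kalman_gain (R : realType) n m (Sxh : 'M[R]_(n, m))
    (Shh Robs : 'M[R]_m) (s : R) : 'M[R]_(n, m) :=
  Sxh *m invmx ((s + 1) *: Robs + Shh).

Definition analysis_cov (R : realType) n m (Sxx : 'M[R]_n)
    (Sxh : 'M[R]_(n, m)) (Shh Robs : 'M[R]_m) : 'M[R]_n :=
  Sxx - Sxh *m invmx (Robs + Shh) *m Sxh^T.

(* Main.v *)
(* Write Robs = S S with S symmetric positive definite, so that Shh = S C S and
   (s + 1) Robs + Shh = S ((s + 1) 1 + C) S. Diagonalizing the symmetric matrix C
   turns the integral of p_t K(s_t) into Sxh N, where N is obtained by applying
   c |-> \int r / ((s + 1) (s + 1 + c)) to the spectrum of C. By partial fractions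
   and the hypothesis, this integral equals nu = 1 / (q (q + 1)) with
   q = sqrt (c + 1). The scalar identity 2 nu - c nu^2 = 1 / (c + 1) becomes
   2 N - N Shh N = (Robs + Shh)^-1, which is what the expansion of
   Cov (Zf - Sxh N Wf) requires. *)
Require Import Defs.
From HB Require Import structures.
From mathcomp Require Import all_boot all_order all_algebra.
From mathcomp Require Import all_classical all_reals all_analysis.
From mathcomp Require Import complex spectral sesquilinear measurable_realfun.
From mathcomp Require Import ring lra.

Set Implicit Arguments.
Unset Strict Implicit.
Unset Printing Implicit Defensive.

Import Order.TTheory GRing.Theory Num.Theory.
Import numFieldNormedType.Exports.

Local Open Scope classical_set_scope.
Local Open Scope ring_scope.

(** * Spectral calculus for real symmetric matrices *)

(** The spectral theorem is applied over [R[i]], where a Hermitian matrix has real eigenvalues, and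
    [real_similar] turns the resulting unitary similarity into a real one. The real [V] is only
    claimed to be invertible, not orthogonal. *)
Lemma symmetric_diagonalizable (R : rcfType) n (A : 'M[R]_n) : A^T = A ->
  exists V : 'M[R]_n, exists d : 'rV[R]_n,
    V \in unitmx /\ V *m A = diag_mx d *m V.
Proof.
move=> As; pose i := real_complex R : {rmorphism R -> R[i]}.
have real_map m p (B : 'M[R]_(m, p)) : map_mx i B \is a mxOver Num.real.
  by apply/mxOverP => j k; rewrite mxE /= complex_real.
have map_real m p (B : 'M[R[i]]_(m, p)) :
    B \is a mxOver Num.real -> exists B', B = map_mx i B'.
  move=> /mxOverP Br; exists (map_mx (@complex.Re R) B).
  by apply/matrixP => j k; rewrite !mxE [RHS]RRe_real.
have Asym : map_mx i A \is symmetricmx.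
  by apply/is_hermitianmxP; rewrite expr0 scale1r map_mx_id // map_trmx As.
have Aherm := realsym_hermsym Asym (real_map _ _ A).
have [D Dd] := map_real _ _ _ (hermitian_spectral_diag_real Aherm).
have /orthomx_spectralP := hermitian_normalmx Aherm.
rewrite Dd -map_diag_mx; set Q := spectralmx _ => AE.
have Qu : Q \in unitmx by exact: spectral_unit.
have [|P] := real_similar _ (real_map _ _ A) (real_map _ _ (diag_mx D)).
  exists Q => //; apply/similarP => //.
  by rewrite {1}AE !mulmxA mulmxV // mul1mx.
rewrite inE => /andP[/map_real[V ->]] Vu /(similarP Vu).
rewrite -!map_mxM => /map_mx_inj VA.
by exists V, D; split=> //; rewrite -(map_unitmx i).
Qed.

(** Stands in for orthogonality of [V]: the condition on [g] makes it a function of the eigenvalues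
    [d], and such a function of a symmetric matrix stays symmetric. *)
Lemma tr_conj_diag (R : fieldType) n (V : 'M[R]_n) (d g : 'rV[R]_n) :
  V \in unitmx ->
  (forall i j, d 0 i = d 0 j -> g 0 i = g 0 j) ->
  (invmx V *m diag_mx d *m V)^T = invmx V *m diag_mx d *m V ->
  (invmx V *m diag_mx g *m V)^T = invmx V *m diag_mx g *m V.
Proof.
move=> Vu dg; have VTu : V^T \in unitmx by rewrite unitmx_tr.
(* The Gram matrix of the rows of V commutes with diag_mx d, hence relates only
   rows with equal d-values. *)
have conjP (e : 'rV[R]_n) : (invmx V *m diag_mx e *m V)^T =
    invmx V *m diag_mx e *m V <->
    V *m V^T *m diag_mx e = diag_mx e *m (V *m V^T).
  rewrite !trmx_mul tr_diag_mx trmx_inv; split.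
    move=> /(congr1 (fun X => V *m X *m V^T)).
    by rewrite !mulmxA mulmxKV // mulmxV // mul1mx.
  move=> H; apply: (can_inj (mulKmx Vu)); apply: (can_inj (mulmxK VTu)).
  by rewrite !mulmxA mulmxKV // H mulmxV // mul1mx !mulmxA.
move=> /conjP /matrixP dG; apply/conjP/matrixP => i j.
move: (dG i j); rewrite !mul_mx_diag !mul_diag_mx !mxE.
set x := \sum_(k < n) _; rewrite mulrC => /eqP.
rewrite -subr_eq0 -mulrBl mulf_eq0.
by rewrite subr_eq0 => /orP[/eqP/dg->|/eqP->]; rewrite ?mulr0 ?mul0r // mulrC.
Qed.

Lemma sqnorm_gt0 (R : realDomainType) n (v : 'cV[R]_n) :
  v != 0 -> 0 < (v^T *m v) 0 0.
Proof.
move=> v0; have [i vi] : exists i, v i 0 != 0.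
  apply/existsP; apply: contraNT v0; rewrite negb_exists => /forallP v0.
  apply/eqP/matrixP => i j; rewrite ord1 mxE; apply/eqP.
  by rewrite -[_ == _]negbK.
rewrite mxE (bigD1 i) //= !mxE -expr2 ltr_wpDr ?exprn_even_gt0 ?orbT //.
by rewrite sumr_ge0 // => j _; rewrite !mxE -expr2 sqr_ge0.
Qed.

Lemma row_diagonalized (R : fieldType) n (V A : 'M[R]_n) (d : 'rV[R]_n) i :
  V \in unitmx -> V *m A = diag_mx d *m V ->
  row i V *m A = d 0 i *: row i V /\ row i V != 0.
Proof.
move=> Vu VA; split.
  by rewrite -row_mul VA; apply/rowP => j; rewrite mul_diag_mx !mxE.
apply: contraL Vu => /eqP Vi; rewrite -row_free_unit; apply/row_freePn.
by exists i; rewrite Vi sub0mx.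
Qed.

(** Passes sign information from a quadratic form to the eigenvalues: the rows of [V] are left
    eigenvectors of [A]. *)
Lemma rayleigh_row (R : realFieldType) n (V A : 'M[R]_n) (d : 'rV[R]_n) i :
  V \in unitmx -> V *m A = diag_mx d *m V ->
  exists2 v : 'cV[R]_n, v != 0 &
    (v^T *m A *m v) 0 0 = d 0 i * (v^T *m v) 0 0.
Proof.
move=> Vu VA; have [e v0] := row_diagonalized i Vu VA.
exists (row i V)^T; first by rewrite -trmx0 (inj_eq trmx_inj).
by rewrite trmxK e -scalemxAl mxE.
Qed.

Lemma mxsqrt_exists (R : rcfType) n (A : 'M[R]_n) :
  A^T = A -> (forall v : 'cV[R]_n, v != 0 -> 0 < (v^T *m A *m v) 0 0) ->
  exists S : 'M[R]_n, [/\ S^T = S,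
    forall v : 'cV[R]_n, v != 0 -> 0 < (v^T *m S *m v) 0 0 & S *m S = A].
Proof.
move=> As Apos; have [V [d [Vu VA]]] := symmetric_diagonalizable As.
have AE : A = invmx V *m diag_mx d *m V by rewrite -mulmxA -VA mulKmx.
have d0 i : 0 < d 0 i.
  have [v v0 e] := rayleigh_row i Vu VA; have := Apos _ v0.
  by rewrite e pmulr_lgt0 // sqnorm_gt0.
pose f (g : R -> R) := invmx V *m diag_mx (map_mx g d) *m V.
have fs g : (f g)^T = f g.
  apply: (@tr_conj_diag _ _ _ d) => //; last by rewrite -AE.
  by move=> i j e; rewrite !mxE e.
have fM g h : f g *m f h = f (fun x => g x * h x).
  rewrite /f !mulmxA mulmxK // -(mulmxA (invmx V)) mulmx_diag.
  by congr (_ *m diag_mx _ *m _); apply/rowP => i; rewrite !mxE.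
have sqrtM (g : R -> R) : (forall i, 0 <= g (d 0 i)) ->
    f (fun x => Num.sqrt (g x)) *m f (fun x => Num.sqrt (g x)) = f g.
  move=> g0; rewrite fM; congr (_ *m diag_mx _ *m _); apply/rowP => i.
  by rewrite !mxE -expr2 sqr_sqrtr.
(* [T] is a symmetric invertible fourth root of [A]. The square root is [T *m T], so its quadratic
   form at [v] is the squared norm of [T *m v], whence definiteness. *)
pose T := f (fun x => Num.sqrt (Num.sqrt x)).
have Ts : T^T = T by exact: fs.
have Tu : T \in unitmx.
  rewrite !unitmx_mul unitmx_inv Vu /= andbT unitmxE det_diag unitfE.
  by apply/prodf_neq0 => i _; rewrite mxE gt_eqF // !sqrtr_gt0.
exists (f Num.sqrt); split => //.
  move=> v v0; rewrite -(sqrtM Num.sqrt) => [|i]; last exact: sqrtr_ge0.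
  rewrite -/T mulmxA -(mulmxA (_ *m T)) -{1}Ts -trmx_mul.
  rewrite sqnorm_gt0 //; apply: contra_neq v0 => e.
  by rewrite -(mulKmx Tu v) e mulmx0.
rewrite (sqrtM id) => [|i]; last exact: ltW.
by rewrite AE /f map_mx_id.
Qed.

(** [F g] is S^-1 g(C) S^-1, with the diagonalization of [C] split between [L] and [Q]. The outer
    factors cancel those of S C S and of a S^2 + S C S = S (a + C) S, so products and inverses
    become scalar ones on the eigenvalues. *)
Lemma pencil_calculus (R : rcfType) n (S C : 'M[R]_n) :
  S^T = S -> S \in unitmx -> C^T = C ->
  exists L Q : 'M[R]_n, exists d : 'rV[R]_n,
    let F g := L *m diag_mx (map_mx g d) *m Q in
    [/\ forall i, eigenvalue C (d 0 i),
        forall i, exists2 v : 'cV[R]_n, v != 0 &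
          (v^T *m C *m v) 0 0 = d 0 i * (v^T *m v) 0 0,
        forall g, (F g)^T = F g,
        forall g h, F g *m (S *m C *m S) *m F h = F (fun x => g x * x * h x) &
        forall a g, (forall i, (a + d 0 i) * g (d 0 i) = 1) ->
          invmx (a *: (S *m S) + S *m C *m S) = F g].
Proof.
move=> Ss Su Cs; have [V [d [Vu VC]]] := symmetric_diagonalizable Cs.
have CE : C = invmx V *m diag_mx d *m V by rewrite -mulmxA -VC mulKmx.
have iSs : (invmx S)^T = invmx S by rewrite trmx_inv Ss.
exists (invmx S *m invmx V), (V *m invmx S), d; split.
- move=> i; have [e v0] := row_diagonalized i Vu VC.
  by apply/eigenvalueP; exists (row i V).
- by move=> i; exact: (rayleigh_row i Vu VC).
- move=> g; have := @tr_conj_diag _ _ V d (map_mx g d) Vu.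
  rewrite -CE => /(_ _ Cs) H; rewrite !mulmxA.
  rewrite -(mulmxA (invmx S)) -(mulmxA (invmx S)) trmx_mul iSs trmx_mul iSs.
  by rewrite H ?mulmxA // => i j e; rewrite !mxE e.
- move=> g h; rewrite {1}CE !mulmxA !mulmxKV // !mulmxK //.
  rewrite -(mulmxA (invmx S *m invmx V)) mulmx_diag.
  rewrite -(mulmxA (invmx S *m invmx V)) mulmx_diag.
  by congr (_ *m diag_mx _ *m _ *m _); apply/rowP => i; rewrite !mxE.
- move=> a g ag; set X := _ + _; set Y := (X in _ = X).
  suff XY : X *m Y = 1%:M.
    have [Xu _] := mulmx1_unit XY.
    by rewrite -[RHS]mul1mx -(mulVmx Xu) -mulmxA XY mulmx1.
  have -> : X = S *m invmx V *m diag_mx (map_mx (fun x => a + x) d) *m (V *m S).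
    have -> : diag_mx (map_mx (fun x => a + x) d) = a%:M + diag_mx d.
      by apply/matrixP => i j; rewrite !mxE -mulrnDl.
    rewrite /X CE mulmxDr mulmxDl !mulmxA; congr (_ + _).
    by rewrite mul_mx_scalar -!scalemxAl mulmxKV.
  rewrite /Y !mulmxA mulmxK // mulmxK // -(mulmxA (S *m _)) mulmx_diag.
  rewrite (_ : diag_mx _ = 1%:M) ?mulmx1 ?mulmxKV ?mulmxV //.
  by apply/matrixP => i j; rewrite !mxE ag.
Qed.

Lemma posdef_unitmx (R : realFieldType) n (A : 'M[R]_n) :
  (forall v : 'cV[R]_n, v != 0 -> 0 < (v^T *m A *m v) 0 0) -> A \in unitmx.
Proof.
move=> Apos; rewrite -row_free_unit -kermx_eq0; apply/negPn/negP => /rowV0Pn[u].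
move=> /sub_kermxP uA u0.
have /Apos : u^T != 0 by rewrite -trmx0 (inj_eq trmx_inj).
by rewrite trmxK uA mul0mx mxE ltxx.
Qed.

Lemma mxsqrtP (R : realType) n (A : 'M[R]_n) : sym_posdef A ->
  [/\ (mxsqrt A)^T = mxsqrt A, mxsqrt A \in unitmx & mxsqrt A *m mxsqrt A = A].
Proof.
move=> [As Apos]; have [S [Ss Spos SA]] := mxsqrt_exists As Apos.
have [[Ts Tpos] TA] := xgetPex 0 (ex_intro _ S (conj (conj Ss Spos) SA) :
  exists S, [set S | sym_posdef S /\ S *m S = A] S).
by split => //; exact: posdef_unitmx.
Qed.

(** * Entrywise integration of matrices, over an arbitrary measure *)

Section matrix_integral.
Context disp (T : measurableType disp) (R : realType).
Variables (mu : {measure set T -> \bar R}) (D : set T).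
Hypothesis mD : measurable D.

Lemma Rintegral_lincomb m (f : 'I_m -> T -> R) (c : 'I_m -> R) :
  (forall k, mu.-integrable D (EFin \o f k)) ->
  mu.-integrable D (EFin \o (fun x => \sum_k c k * f k x)) /\
  \int[mu]_(x in D) (\sum_k c k * f k x) = \sum_k c k * \int[mu]_(x in D) f k x.
Proof.
move=> intf.
have intc k : mu.-integrable D (fun x => (c k * f k x)%:E).
  by under eq_fun do rewrite EFinM; apply: integrableZl => //; exact: intf.
split.
  rewrite /comp; under eq_fun do rewrite -sumEFin.
  by apply: integrable_sum => // k _; exact: intc.
rewrite /Rintegral; under eq_integral do rewrite -sumEFin.
rewrite integral_sum // -sum_fine => [|k _]; last exact: integrable_fin_num.
by apply: eq_bigr => k _; rewrite -[LHS]/(Rintegral _ _ _) RintegralZl.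
Qed.

(* For the Lebesgue measure these are mxintegral and mxintegrable of Defs, by
   conversion. *)
Definition mxRintegral m n (F : T -> 'M[R]_(m, n)) : 'M[R]_(m, n) :=
  \matrix_(i, j) \int[mu]_(x in D) F x i j.

Definition mxRintegrable m n (F : T -> 'M[R]_(m, n)) : Prop :=
  forall i j, mu.-integrable D (fun x => (F x i j)%:E).

Lemma mxRintegral_mull m n k (A : 'M[R]_(m, n)) (F : T -> 'M[R]_(n, k)) :
  mxRintegrable F -> mxRintegrable (fun x => A *m F x) /\
  mxRintegral (fun x => A *m F x) = A *m mxRintegral F.
Proof.
move=> intF.
have H i j := @Rintegral_lincomb _ (fun l x => F x l j) (A i)
  (fun l => intF l j).
split=> [i j|].
  by under eq_fun do rewrite mxE; exact: (H i j).1.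
apply/matrixP => i j; rewrite !mxE.
under eq_Rintegral do rewrite mxE.
by rewrite (H i j).2; apply: eq_bigr => l _; rewrite mxE.
Qed.

Lemma mxRintegral_tr m n (F : T -> 'M[R]_(m, n)) :
  mxRintegral (fun x => (F x)^T) = (mxRintegral F)^T.
Proof.
by apply/matrixP => i j; rewrite !mxE; under eq_Rintegral do rewrite mxE.
Qed.

Lemma mxRintegrable_tr m n (F : T -> 'M[R]_(m, n)) :
  mxRintegrable F -> mxRintegrable (fun x => (F x)^T).
Proof. by move=> intF i j; under eq_fun do rewrite mxE; exact: intF. Qed.

Lemma mxRintegral_mulr m n k (F : T -> 'M[R]_(m, n)) (A : 'M[R]_(n, k)) :
  mxRintegrable F -> mxRintegrable (fun x => F x *m A) /\
  mxRintegral (fun x => F x *m A) = mxRintegral F *m A.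
Proof.
move=> /mxRintegrable_tr /(mxRintegral_mull A^T)[iAF eAF].
have E : (fun x => F x *m A) = (fun x => (A^T *m (F x)^T)^T).
  by apply/funext => x; rewrite trmx_mul !trmxK.
rewrite E; split; first exact: mxRintegrable_tr.
by rewrite mxRintegral_tr eAF mxRintegral_tr trmx_mul !trmxK.
Qed.

Lemma mxRintegralB m n (F G : T -> 'M[R]_(m, n)) :
  mxRintegrable F -> mxRintegrable G -> mxRintegrable (fun x => F x - G x) /\
  mxRintegral (fun x => F x - G x) = mxRintegral F - mxRintegral G.
Proof.
move=> intF intG; split=> [i j|].
  rewrite (_ : (fun x => _) = (fun x => (F x i j)%:E - (G x i j)%:E)%E).
    by apply: integrableB.
  by apply/funext => x; rewrite !mxE EFinB.
apply/matrixP => i j; rewrite !mxE -RintegralB //; [|exact: intF|exact: intG].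
by apply: eq_Rintegral => x _; rewrite !mxE.
Qed.

End matrix_integral.

(** * Scalar gain integrals *)

(** Prepares the limit c -> 0, where 1 / (q (q + 1)) tends to 1/2; both bounds follow from 1 < q <=
    1 + c. *)
Lemma gain_bounds (R : realFieldType) (q c : R) :
  0 < c -> 0 < q -> q ^+ 2 = c + 1 ->
  2^-1 - c <= (q * (q + 1))^-1 /\ (1 + c) * (q * (q + 1))^-1 <= 2^-1 + c.
Proof.
move=> c0 q0 q2.
have q1 : 1 < q by rewrite -(@ltr_pXn2r _ 2) ?nnegrE ?ltW // q2; lra.
have qc : q <= 1 + c by rewrite addrC -q2 expr2 ler_peMr // ltW.
have q10 : 0 < q + 1 by lra.
have qq0 : 0 < q * (q + 1) by rewrite mulr_gt0.
split.
  rewrite -[leRHS]mul1r ler_pdivlMr // mulrDr mulr1 -expr2 q2.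
  (* For c >= 1/2 the left side is nonpositive. Otherwise q <= 1 + c bounds it by (1/2 - c) (2 + 2
     c) = 1 - c - 2 c^2. *)
  have [|cl] := leP 2^-1 c; first by move=> ?; nra.
  have : (2^-1 - c) * (c + 1 + q) <= (2^-1 - c) * (c + 1 + (1 + c)).
    by apply: ler_wpM2l; lra.
  by have := sqr_ge0 c; rewrite expr2; lra.
rewrite ler_pdivrMr // [leRHS]mulrCA.
have -> : 1 + c = q * q by rewrite -expr2 q2 addrC.
rewrite ler_pM2l //.
by have := mulr_gt0 c0 q0; lra.
Qed.

Lemma gain_identity (R : rcfType) (c : R) : 0 <= c ->
  let nu := (Num.sqrt (c + 1) * (Num.sqrt (c + 1) + 1))^-1 in
  nu * c * nu = nu + nu - (1 + c)^-1.
Proof.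
move=> c0 /=; set q := Num.sqrt _.
have q2 : q ^+ 2 = c + 1 by rewrite sqr_sqrtr // addr_ge0.
have q0 : 0 < q by rewrite sqrtr_gt0 ltr_wpDl.
have -> : 1 + c = q ^+ 2 by rewrite addrC.
(* Eliminating c leaves a rational identity in q, within reach of [field]. *)
have -> : c = q ^+ 2 - 1 by rewrite q2 addrK.
by field; apply/andP; split; rewrite gt_eqF // addr_gt0.
Qed.

Lemma measurable_inv_shift (R : realType) (I : set R) (s : R -> R) (c : R) :
  measurable_fun I s -> (forall t, I t -> 0 <= s t) -> 0 < c ->
  measurable_fun I (fun t => (s t + c)^-1).
Proof.
move=> ms s0 c0.
(* On [I], [s] equals its absolute value, and x |-> 1 / (|x| + c) is continuous on the whole line,
   having no pole. *)
apply: (eq_measurable_fun ((fun x => (`|x| + c)^-1) \o s)).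
  by move=> t /set_mem It /=; rewrite ger0_norm ?s0.
apply: measurableT_comp => //; apply: continuous_measurable_fun => x.
apply: cvgV; first by rewrite gt_eqF // ltr_wpDl.
by apply: cvgD; [exact: cvg_norm|exact: cvg_cst].
Qed.

Section observation_filter.
Variables (R : realType) (I U : set R) (r s : R -> R).
Let mu := @lebesgue_measure R.
Hypotheses (mI : measurable I) (mr : measurable_fun I r).
Hypotheses (ms : measurable_fun I s) (r0 : forall t, I t -> 0 <= r t).
Hypotheses (s0 : forall t, I t -> 0 <= s t) (oU : open U) (U0 : U 0).
Hypothesis filterE : forall c, U c ->
  (\int[mu]_(t in I) (r t / (s t + c + 1))%:E)%E = ((Num.sqrt (c + 1))^-1)%:E.

Let h c t := r t / (s t + c + 1).

Let p t := r t * (s t + 1)^-1.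

Let integrable_h c : U c -> 0 <= c -> mu.-integrable I (EFin \o h c).
Proof.
move=> Uc c0; have mh : measurable_fun I (h c).
  apply: measurable_funM => //; under eq_fun do rewrite -addrA.
  by apply: measurable_inv_shift => //; rewrite ltr_wpDl.
apply/integrableP; split; first exact/measurable_EFinP.
(* The integrand is nonnegative on [I], so the integral of its absolute value is the finite value
   given by the hypothesis. *)
rewrite [ltLHS](@eq_integral _ _ _ mu I (fun t => (h c t)%:E)).
  by rewrite filterE // ltry.
move=> t /set_mem It /=; rewrite ger0_norm // divr_ge0 ?r0 //.
by rewrite !addr_ge0 ?s0.
Qed.

Let h0E : h 0 = p.
Proof. by apply/funext => t; rewrite /h addr0. Qed.

Let integrable_p : mu.-integrable I (EFin \o p).
Proof. by rewrite -h0E; exact: integrable_h. Qed.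

Let p_ge0 t : I t -> 0 <= p t.
Proof. by move=> It; rewrite divr_ge0 ?addr_ge0 ?r0 ?s0. Qed.

(** [g^~ t] is the function on the spectrum of C that represents p_t ((s_t + 1) Robs + Shh)^-1. *)
Let g c t := p t * (s t + 1 + c)^-1.

Lemma integral_gain_weight : (\int[mu]_(t in I) (p t)%:E)%E = 1%E.
Proof. by rewrite -h0E filterE // add0r sqrtr1 invr1. Qed.

(** Domination by [p], since s_t + 1 + c >= 1. *)
Lemma integrable_gain c : 0 <= c -> mu.-integrable I (EFin \o g c).
Proof.
move=> c0; apply: le_integrable integrable_p => //.
  apply/measurable_EFinP/measurable_funM.
    by case/integrableP : integrable_p => /measurable_EFinP.
  under eq_fun do rewrite -addrA; apply: measurable_inv_shift => //.
  by rewrite ltr_pwDl.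
move=> t It /=; rewrite lee_fin normrM ler_piMr // ger0_norm; last first.
  by rewrite invr_ge0 !addr_ge0 ?s0.
by have st := s0 It; rewrite invf_le1; lra.
Qed.

Let Rintegral_h c : U c -> \int[mu]_(t in I) h c t = (Num.sqrt (c + 1))^-1.
Proof. by move=> Uc; rewrite /Rintegral filterE. Qed.

(** Partial fractions give c g_c = h_0 - h_c, with integral 1 - 1/q. As c = (q - 1) (q + 1), it
    remains to divide by q - 1, which is positive because c > 0. *)
Let Rintegral_gain_neq0 c : U c -> 0 < c ->
  \int[mu]_(t in I) g c t = (Num.sqrt (c + 1) * (Num.sqrt (c + 1) + 1))^-1.
Proof.
move=> Uc c0; set q := Num.sqrt _.
have q2 : q ^+ 2 = c + 1 by rewrite sqr_sqrtr // addr_ge0 // ltW.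
have q0 : 0 < q by rewrite sqrtr_gt0 addr_gt0.
have : \int[mu]_(t in I) (c * g c t) = 1 - q^-1.
  rewrite -(Rintegral_h Uc) -[1](_ : \int[mu]_(t in I) h 0 t = 1); last first.
    by rewrite Rintegral_h // add0r sqrtr1 invr1.
  rewrite -RintegralB //; [|exact: integrable_h|exact: integrable_h (ltW c0)].
  apply: eq_Rintegral => t /set_mem /s0 st; rewrite /g /h /p.
  by field; apply/andP; split; rewrite gt_eqF //; lra.
rewrite RintegralZl //; last exact: integrable_gain (ltW c0).
have -> : c = (q - 1) * (q + 1) by rewrite -subr_sqr q2 expr1n addrK.
have q1 : 0 < q - 1.
  by rewrite subr_gt0 -(@ltr_pXn2r _ 2) ?nnegrE ?ltW // q2; lra.
set J := \int[mu]_(t in I) _ => e.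
have qq : q * (q + 1) != 0 by rewrite mulf_neq0 ?gt_eqF ?addr_gt0.
apply: (mulIf qq); rewrite mulVf //; apply: (mulfI (lt0r_neq0 q1)).
transitivity (q * ((q - 1) * (q + 1) * J)); first by ring.
by rewrite e; field; rewrite gt_eqF.
Qed.

(* The instance c = 0 is the derivative at 0 of the hypothesis; the integrals for
   small c > 0 squeeze it, since g c <= g 0 <= (1 + c) * g c. *)
Let Rintegral_gain_0 : \int[mu]_(t in I) g 0 t = 2^-1.
Proof.
(* Openness of [U] supplies small positive [c] at which the hypothesis holds. *)
have [e e0 eU] : exists2 e : R, 0 < e & forall x, `|x| < e -> U x.
  have /nbhs_ballP[e e0 eU] : nbhs 0 U by exact: open_nbhs_nbhs.
  by exists e => // x xe; apply: eU; rewrite /ball /= sub0r normrN.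
have squeeze c : 0 < c -> c < e ->
    2^-1 - c <= \int[mu]_(t in I) g 0 t <= 2^-1 + c.
  move=> c0 ce; have Uc : U c by apply: eU; rewrite gtr0_norm.
  have gle t : I t -> g c t <= g 0 t <= (1 + c) * g c t.
    move=> It; have st := s0 It; rewrite /g addr0; apply/andP; split.
      by apply: ler_wpM2l; [exact: p_ge0|rewrite lef_pV2 ?posrE; lra].
    rewrite mulrCA; apply: ler_wpM2l; first exact: p_ge0.
    rewrite ler_pdivlMr; last by lra.
    rewrite mulrC ler_pdivrMr; last by lra.
    (* The upper comparison has been reduced to s_t + 1 + c <= (1 + c) (s_t + 1), that is, 0 <= c
       s_t. *)
    have : 0 <= c * s t by rewrite mulr_ge0 // ltW.
    by rewrite mulrDl mul1r mulrDr mulr1; lra.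
  have q2 : Num.sqrt (c + 1) ^+ 2 = c + 1.
    by rewrite sqr_sqrtr // addr_ge0 // ltW.
  have q0 : 0 < Num.sqrt (c + 1) by rewrite sqrtr_gt0 addr_gt0.
  have [blo bhi] := gain_bounds c0 q0 q2.
  have [i0 ic] := (integrable_gain (lexx 0), integrable_gain (ltW c0)).
  rewrite -(Rintegral_gain_neq0 Uc c0) in blo bhi.
  apply/andP; split.
    apply: le_trans blo _; apply: le_Rintegral => // t /gle /andP[]//.
  apply: le_trans bhi; rewrite -RintegralZl //; apply: le_Rintegral => //.
    by rewrite /comp; under eq_fun do rewrite EFinM; exact: integrableZl.
  by move=> t /gle /andP[].
(* The witness is at most the tolerance [x], and the cap [e / 2] keeps it inside the ball contained
   in [U]. *)
have near x : 0 < x -> exists2 c, c <= x & 0 < c < e.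
  move=> x0; exists (Num.min x (e / 2)); first by rewrite ge_min lexx.
  by rewrite lt_min gt_min x0 divr_gt0 // ltr_pdivrMr // ltr_pMr // ltr1n orbT.
apply/eqP; rewrite eq_le; apply/andP; split; apply/ler_addgt0Pr => x /near.
  move=> [c cx /andP[c0 ce]]; have /andP[_ /le_trans] := squeeze c c0 ce.
  by apply; rewrite lerD2l.
move=> [c cx /andP[c0 ce]]; have /andP[+ _] := squeeze c c0 ce.
by rewrite lerBlDr => /le_trans; apply; rewrite lerD2l.
Qed.

Lemma Rintegral_gain c : U c -> 0 <= c ->
  \int[mu]_(t in I) g c t = (Num.sqrt (c + 1) * (Num.sqrt (c + 1) + 1))^-1.
Proof.
move=> Uc; rewrite le_eqVlt => /predU1P[<-|]; last exact: Rintegral_gain_neq0.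
by rewrite Rintegral_gain_0 add0r sqrtr1 mul1r.
Qed.

End observation_filter.

(** Lets the integral enter the spectral calculus: off-diagonal entries vanish, leaving one scalar
    integral per entry of [d]. *)
Lemma mxRintegral_diag disp (T : measurableType disp) (R : realType)
    (mu : {measure set T -> \bar R}) (D : set T) n (d : 'rV[R]_n)
    (g : R -> T -> R) :
  measurable D -> (forall j, mu.-integrable D (EFin \o g (d 0 j))) ->
  mxRintegrable mu D (fun x => diag_mx (map_mx (g^~ x) d)) /\
  mxRintegral mu D (fun x => diag_mx (map_mx (g^~ x) d)) =
    diag_mx (map_mx (fun c => \int[mu]_(x in D) g c x) d).
Proof.
move=> mD ig; split=> [i j|]; last apply/matrixP => i j.
  under eq_fun do rewrite !mxE; case: eqP => _; first exact: ig.
  exact: integrable0.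
rewrite !mxE; under eq_Rintegral do rewrite !mxE.
by case: eqP => _ //; rewrite mulr0n /Rintegral integral0.
Qed.

(** * Expectations and second moments of random vectors *)

Section second_moments.
Context disp (T : measurableType disp) (R : realType) (P : probability T R).

(** The bridge to the matrix-integral lemmas, which then apply to [P] as they do to Lebesgue
    measure. *)
Lemma mxexpectationE m n (M : T -> 'M[R]_(m, n)) :
  mxexpectation P M = mxRintegral P setT M.
Proof. by apply/matrixP => i j; rewrite !mxE unlock. Qed.

Lemma mxexpectation_cst m n (A : 'M[R]_(m, n)) : mxexpectation P (fun=> A) = A.
Proof. by apply/matrixP => i j; rewrite mxE expectation_cst. Qed.

Lemma finite_second_momentsB n (X Y : T -> 'cV[R]_n) :
  finite_second_moments P X -> finite_second_moments P Y ->
  finite_second_moments P (fun w => X w - Y w).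
Proof.
move=> X2 Y2 i.
rewrite (_ : (fun w => _) = (fun w => X w i 0) \- (fun w => Y w i 0)).
  by rewrite rpredB ?lee1n.
by apply/funext => w; rewrite !mxE.
Qed.

Lemma finite_second_moments_cst n (a : 'cV[R]_n) :
  finite_second_moments P (fun=> a).
Proof. by move=> i; exact: Lfun_cst. Qed.

Lemma finite_second_moments_mulmx m n (A : 'M[R]_(m, n)) (X : T -> 'cV[R]_n) :
  finite_second_moments P X -> finite_second_moments P (fun w => A *m X w).
Proof.
move=> X2 i.
rewrite (_ : (fun w => _) = \sum_j (A i j \o* (fun w => X w j 0))).
  by rewrite rpred_sum ?lee1n // => p12 k _; rewrite Lfun_scale ?ler1n.
apply/funext => w; rewrite mxE fct_sumE; apply: eq_bigr => j _ /=.
by rewrite mulrC.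
Qed.

Lemma finite_second_moments_integrable n (X : T -> 'cV[R]_n) :
  finite_second_moments P X -> mxRintegrable P setT X.
Proof.
move=> X2 i j; rewrite ord1; apply/Lfun1_integrable.
by apply: Lfun_subset12; [exact: fin_num_measure|exact: X2].
Qed.

Lemma outer_integrable m n (X : T -> 'cV[R]_m) (Y : T -> 'cV[R]_n) :
  finite_second_moments P X -> finite_second_moments P Y ->
  mxRintegrable P setT (fun w => X w *m (Y w)^T).
Proof.
move=> X2 Y2 i j; under eq_fun do rewrite mxE big_ord1 mxE.
exact/Lfun1_integrable/(Lfun2_mul_Lfun1 (X2 i) (Y2 j)).
Qed.

Lemma mxexpectation_centered n (X : T -> 'cV[R]_n) :
  finite_second_moments P X ->
  mxexpectation P (fun w => X w - mxexpectation P X) = 0.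
Proof.
move=> X2; have iX := finite_second_moments_integrable X2.
have ic := finite_second_moments_integrable
  (@finite_second_moments_cst n (mxexpectation P X)).
rewrite mxexpectationE (mxRintegralB measurableT iX ic).2 -!mxexpectationE.
by rewrite mxexpectation_cst subrr.
Qed.

(** The quadratic form is the expectation of the square of v^T X. For the centered observation it
    makes [Shh] positive semidefinite. *)
Lemma mxexpectation_quad_ge0 n (X : T -> 'cV[R]_n) (v : 'cV[R]_n) :
  finite_second_moments P X ->
  0 <= (v^T *m mxexpectation P (fun w => X w *m (X w)^T) *m v) 0 0.
Proof.
move=> X2; have iXX := outer_integrable X2 X2.
have [ivXX evXX] := mxRintegral_mull measurableT v^T iXX.
rewrite mxexpectationE -evXX -(mxRintegral_mulr measurableT v ivXX).2 mxE.
apply: Rintegral_ge0 => w _.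
rewrite mulmxA -mulmxA -{2}(trmxK v) -trmx_mul mxE big_ord1 [X in _ * X]mxE.
by rewrite -expr2 sqr_ge0.
Qed.

(** Bilinear expansion, with E[Y X^T] written as the transpose of E[X Y^T] so that only three second
    moments occur; for X = Z_f and Y = W_f these are [Sxx], [Sxh] and [Shh]. *)
Lemma mxexpectation_residual m n (X : T -> 'cV[R]_m) (Y : T -> 'cV[R]_n)
    (B : 'M[R]_(m, n)) :
  let E k l (U : T -> 'cV[R]_k) (V : T -> 'cV[R]_l) :=
    mxexpectation P (fun w => U w *m (V w)^T) in
  finite_second_moments P X -> finite_second_moments P Y ->
  E _ _ (fun w => X w - B *m Y w) (fun w => X w - B *m Y w) =
  E _ _ X X - E _ _ X Y *m B^T - (B *m (E _ _ X Y)^T - B *m E _ _ Y Y *m B^T).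
Proof.
move=> E X2 Y2; rewrite /E !mxexpectationE.
have iXX := outer_integrable X2 X2; have iXY := outer_integrable X2 Y2.
have iYX := outer_integrable Y2 X2; have iYY := outer_integrable Y2 Y2.
have [iXYB eXYB] := mxRintegral_mulr measurableT B^T iXY.
have [iBYX eBYX] := mxRintegral_mull measurableT B iYX.
have [iBYY eBYY] := mxRintegral_mull measurableT B iYY.
have [iBYYB eBYYB] := mxRintegral_mulr measurableT B^T iBYY.
have [i1 e1] := mxRintegralB measurableT iXX iXYB.
have [i2 e2] := mxRintegralB measurableT iBYX iBYYB.
rewrite -mxRintegral_tr -eXYB -eBYY -eBYYB -e1.
under [X in B *m mxRintegral _ _ X]eq_fun do rewrite trmx_mul trmxK.
rewrite -eBYX -e2 -(mxRintegralB measurableT i1 i2).2; congr mxRintegral.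
by apply/funext => w; rewrite linearB /= trmx_mul mulmxBl !mulmxBr !mulmxA.
Qed.

End second_moments.

(** * Mean and covariance of the analysis variable *)

Theorem theorem3 (R : realType) (disp : measure_display)
    (T : measurableType disp) (P : probability T R) (n d : nat)
    (Xf : T -> 'cV[R]_n) (h : 'cV[R]_n -> 'cV[R]_d) (Robs : 'M[R]_d)
    (I : set R) (r s : R -> R) :
  let hX : T -> 'cV[R]_d := fun w => h (Xf w) in
  let Sxx := Cov P Xf Xf in
  let Sxh := Cov P Xf hX in
  let Shh := Cov P hX hX in
  let Zf : T -> 'cV[R]_n := fun w => Xf w - mxexpectation P Xf in
  let Wf : T -> 'cV[R]_d := fun w => hX w - mxexpectation P hX in
  let Sa := analysis_cov Sxx Sxh Shh Robs in
  let K := kalman_gain Sxh Shh Robs in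
  let C := invmx (mxsqrt Robs) *m Shh *m invmx (mxsqrt Robs) in
  let p : R -> R := fun t => r t * (s t + 1)^-1 in
  let G : T -> R -> 'cV[R]_n := fun w t => p t *: (K (s t) *m Wf w) in
  let Za : T -> 'cV[R]_n := fun w => Zf w - mxintegral I (G w) in
  finite_second_moments P Xf ->
  finite_second_moments P hX ->
  sym_posdef Robs ->
  is_interval I ->
  {within I, continuous r} ->
  {within I, continuous s} ->
  (forall t, I t -> 0 <= r t) ->
  (forall t, I t -> 0 <= s t) ->
  (exists U : set R,
    [/\ open U,
        [set a | eigenvalue C a] `|` [set 0] `<=` U &
        forall c, U c ->
          (\int[lebesgue_measure]_(t in I) (r t / (s t + c + 1))%:E)%E
            = ((Num.sqrt (c + 1))^-1)%:E]) ->
  (\int[lebesgue_measure]_(t in I) (p t)%:E)%E = 1%E /\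
  [/\ forall w, mxintegrable I (G w),
      finite_second_moments P Za,
      mxexpectation P Za = 0 &
      Cov P Za Za = Sa].
Proof.
move=> hX Sxx Sxh Shh Zf Wf Sa K C p G Za X2 hX2 Rspd Iint cr cs r0 s0.
move=> [U [oU CU filterE]].
have mI : measurable (I : set (measurableTypeR R)).
  exact: is_interval_measurable.
have mr : measurable_fun I r by exact: subspace_continuous_measurable_fun.
have ms : measurable_fun I s by exact: subspace_continuous_measurable_fun.
have U0 : U 0 by apply: CU; right.
split; first exact: integral_gain_weight filterE.
have Z2 : finite_second_moments P Zf.
  exact/finite_second_momentsB/finite_second_moments_cst.
have W2 : finite_second_moments P Wf.
  exact/finite_second_momentsB/finite_second_moments_cst.
have [Ss Su SR] := mxsqrtP Rspd; set S := mxsqrt Robs in Ss Su SR C CU.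
have ShhE : S *m C *m S = Shh by rewrite /C !mulmxA mulmxV // mul1mx mulmxKV.
have Shhs : Shh^T = Shh.
  rewrite /Shh /Cov !mxexpectationE -mxRintegral_tr.
  by congr mxRintegral; apply/funext => w; rewrite trmx_mul trmxK.
have iSs : (invmx S)^T = invmx S by rewrite trmx_inv Ss.
have Cs : C^T = C by rewrite /C !trmx_mul iSs Shhs mulmxA.
have [L [Q [d0 /= [Ceig Cray Fs FM Finv]]]] := pencil_calculus Ss Su Cs.
rewrite ShhE SR in FM Finv.
pose F (g : R -> R) := L *m diag_mx (map_mx g d0) *m Q.
(* The Rayleigh quotient [d0 0 i] of [C] at [v] has the sign of the quadratic form of [Shh] at
   [invmx S *m v]. *)
have d0_ge0 i : 0 <= d0 0 i.
  have [v v0 e] := Cray i; have vv := sqnorm_gt0 v0.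
  rewrite -(pmulr_lge0 _ vv) -e /C !mulmxA -{1}iSs -trmx_mul.
  by rewrite -mulmxA; exact: mxexpectation_quad_ge0.
have Ud0 i : U (d0 0 i) by apply: CU; left; exact: Ceig.
pose g c t := p t * (s t + 1 + c)^-1.
pose q (c : R) := Num.sqrt (c + 1).
pose nu (c : R) := (q c * (q c + 1))^-1.
have ig i : lebesgue_measure.-integrable I (EFin \o g (d0 0 i)).
  exact: (integrable_gain mI mr ms r0 s0 U0 filterE (d0_ge0 i)).
have eg i : \int[lebesgue_measure]_(t in I) g (d0 0 i) t = nu (d0 0 i).
  exact: (Rintegral_gain mI mr ms r0 s0 oU U0 filterE).
have [iD eD] := mxRintegral_diag mI ig.
(* The time dependence sits in the diagonal factor alone, so the fixed matrices on either side can
   leave the integral. The formula is claimed on [I] only, where s_t >= 0 makes the pencil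
   invertible. *)
have GE w t : I t -> G w t =
    Sxh *m L *m diag_mx (map_mx (g^~ t) d0) *m (Q *m Wf w).
  move=> It; rewrite /G /K /kalman_gain (Finv _ (fun c => (s t + 1 + c)^-1)).
    have -> : diag_mx (map_mx (g^~ t) d0) =
        p t *: diag_mx (map_mx (fun c => (s t + 1 + c)^-1) d0).
      by apply/matrixP => i j; rewrite !mxE mulrnAr.
    by rewrite -scalemxAr -!scalemxAl !mulmxA.
  by move=> i; rewrite mulfV // gt_eqF // ltr_wpDr // ltr_wpDl // s0.
have iG w : mxRintegrable lebesgue_measure I (G w) /\
    mxRintegral lebesgue_measure I (G w) = Sxh *m F nu *m Wf w.
  have [iLD eLD] := mxRintegral_mull mI (Sxh *m L) iD.
  have [iLDW eLDW] := mxRintegral_mulr mI (Q *m Wf w) iLD.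
  split=> [i j|].
    by apply: eq_integrable (iLDW i j) => // t /set_mem It; rewrite GE.
  rewrite (_ : F nu = L *m mxRintegral lebesgue_measure I
      (fun t => diag_mx (map_mx (g^~ t) d0)) *m Q); last first.
    rewrite eD; congr (_ *m diag_mx _ *m _); apply/rowP => i.
    by rewrite !mxE eg.
  rewrite !mulmxA -eLD -mulmxA -eLDW; apply/matrixP => i j; rewrite !mxE.
  by apply: eq_Rintegral => t /set_mem It; rewrite GE.
have FnuE : F nu *m Shh *m F nu = F nu + F nu - invmx (Robs + Shh).
  (* [Robs + Shh] is the pencil with a = 1, so every term is a value of [F] and the equation is
     checked on each eigenvalue. *)
  rewrite FM -[Robs]scale1r (Finv _ (fun c => (1 + c)^-1)); last first.
    by move=> i; rewrite mulfV // gt_eqF // ltr_wpDr.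
  rewrite /F -mulmxDl -mulmxBl -mulmxDr -mulmxBr; congr (_ *m _ *m _).
  apply/matrixP => i j; rewrite !mxE -mulrnDl -mulrnBl; congr (_ *+ _).
  exact: gain_identity.
(* The integral is a fixed linear map of W_f, so Z_a is a residual of the form treated in
   [mxexpectation_residual]. *)
have ZaE : Za = fun w => Zf w - Sxh *m F nu *m Wf w.
  by apply/funext => w; rewrite /Za -(iG w).2.
have Za2 : finite_second_moments P Za.
  rewrite ZaE; apply: finite_second_momentsB => //.
  exact: finite_second_moments_mulmx.
have EZa : mxexpectation P Za = 0.
  have iZ := finite_second_moments_integrable Z2.
  have iW := finite_second_moments_integrable W2.
  have [iBW eBW] := mxRintegral_mull measurableT (Sxh *m F nu) iW.
  rewrite ZaE mxexpectationE (mxRintegralB measurableT iZ iBW).2 eBW.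
  by rewrite -!mxexpectationE !mxexpectation_centered // mulmx0 subrr.
split => //; first by move=> w; exact: (iG w).1.
rewrite /Cov EZa (_ : (fun w => _) = fun w => Za w *m (Za w)^T); last first.
  by apply/funext => w; rewrite subr0.
rewrite ZaE; transitivity (Sxx - Sxh *m (Sxh *m F nu)^T -
    (Sxh *m F nu *m Sxh^T - Sxh *m F nu *m Shh *m (Sxh *m F nu)^T)).
  exact: mxexpectation_residual Z2 W2.
have Fnus : (F nu)^T = F nu := Fs nu.
rewrite (_ : Sxh *m F nu *m Shh *m (Sxh *m F nu)^T =
    Sxh *m (F nu *m Shh *m F nu) *m Sxh^T); last first.
  by rewrite trmx_mul Fnus !mulmxA.
(* With N = [F nu], the cross terms contribute -2 Sxh N Sxh^T, which the 2 N from [FnuE] cancels;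
   only -Sxh (Robs + Shh)^-1 Sxh^T remains next to [Sxx]. *)
rewrite FnuE mulmxBr mulmxDr mulmxBl mulmxDl trmx_mul Fnus !mulmxA.
rewrite /Sa /analysis_cov -addrA; congr (_ + _).
by rewrite opprB addrC -addrA -opprD addrAC subrr sub0r.
Qed.
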